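(* Let $X$ be a topological space and let $(S,\rho)$ be a wide inverse semigroup over $X$. Then the space of germs $\mathrm{Germs}(S,\rho)$ can be given the structure of an étale groupoid with object space $X$.
   Context: An inverse semigroup is a semigroup in which every element $s$ has a unique inverse $s^*$ ($ss^*s=s$, $s^*ss^*=s^*$); $E(S)$ denotes its set of idempotents. For a topological space $X$, $\Omega(X)$ is its topology and $\mathcal I(X)$ is the inverse semigroup of all partial homeomorphisms of $X$, i.e. homeomorphisms $h:U\to V$ between open subsets of $X$, with product $hh'$ defined on $h^{-1}(\mathrm{cod}(h)\cap\mathrm{dom}(h'))$ by $(hh')(x)=h'(h(x))$ (first $h$, then $h'$) and $h^*=h^{-1}$. A representation of $S$ on $X$ is a semigroup homomorphism $\rho:S\to\mathcal I(X)$. It is wide if the images of the idempotents cover $X$, i.e. $\bigcup_{f\in E(S)}\mathrm{dom}(\rho(f))=X$; then $(S,\rho)$ is called a wide inverse semigroup over $X$. Germs: for $s\in S$ and $x\in\mathrm{dom}(\rho(s))$, $$\mathrm{germ}_x s=\{t\in S\mid \exists f\in E(S):\ ft=fs,\ x\in\mathrm{dom}(\rho(t))\cap\mathrm{dom}(\rho(f))\},$$ and $\mathrm{Germs}(S,\rho)=\{(x,\mathrm{germ}_x s)\mid s\in S,\ x\in\mathrm{dom}(\rho(s))\}$, with the topology having as basis the sets $V_{s,U}=\{(x,\mathrm{germ}_x s)\mid x\in U\}$ for $s\in S$ and $U\in\Omega(X)$ with $U\subset\mathrm{dom}(\rho(s))$. A topological groupoid $G$ has a space of arrows $G_1$, a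 space of objects $G_0$, and continuous structure maps $d,r:G_1\to G_0$ (domain, range), $u:G_0\to G_1$ (units), $i:G_1\to G_1$ (inverse) and $m:G_1\times_{G_0}G_1\to G_1$, where $xy=m(x,y)$ is defined when $r(x)=d(y)$, satisfying the usual groupoid axioms. It is étale if $d$ is a local homeomorphism. In the statement the space of arrows is $\mathrm{Germs}(S,\rho)$; the structure maps used by the paper are $d(x,\mathrm{germ}_x s)=x$, $r(x,\mathrm{germ}_x s)=\rho(s)(x)$, $1_x=(x,\mathrm{germ}_x f)$ for any $f\in E(S)$ with $x\in\mathrm{dom}(\rho(f))$, $(x,\mathrm{germ}_x s)(\rho(s)(x),\mathrm{germ}_{\rho(s)(x)}t)=(x,\mathrm{germ}_x(st))$, and $(x,\mathrm{germ}_x s)^{-1}=(\rho(s)(x),\mathrm{germ}_{\rho(s)(x)}s^* )$. *)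

(* Defs.v *)
From HB Require Import structures.
From mathcomp Require Import all_boot monoid.
From mathcomp Require Import all_classical topology.

Set Implicit Arguments.
Unset Strict Implicit.
Unset Printing Implicit Defensive.

Local Open Scope classical_set_scope.
Local Open Scope group_scope.

HB.mixin Record Semigroup_isInverse S & Semigroup S := {
  star : S -> S;
  mulgstar : forall s : S, s * star s * s = s;
  starmulg : forall s : S, star s * s * star s = star s;
  star_uniq : forall s t : S, s * t * s = s -> t * s * t = t -> t = star s
}.

#[short(type="inverseSemigroupType")]
HB.structure Definition InverseSemigroup :=
  {S of Semigroup S & Semigroup_isInverse S}.

Definition idempotents (S : semigroupType) : set S := [set f | f * f = f].

Section InverseSemigroupTheory.
Variable S : inverseSemigroupType.
Implicit Types s t e f : S.

Lemma starK s : star (star s) = s.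
Proof. by apply/esym/star_uniq; rewrite ?starmulg ?mulgstar. Qed.

Lemma idem_star f : idempotents f -> star f = f.
Proof. by move=> ff; apply/esym/star_uniq; rewrite !ff. Qed.

Lemma mulgstar_idem s : idempotents (s * star s).
Proof. by rewrite /idempotents /= mulgA mulgstar. Qed.

Lemma idemM e f : idempotents e -> idempotents f -> idempotents (e * f).
Proof.
rewrite /idempotents /= => ee ff.
have eK z : z * e * e = z * e by rewrite -mulgA ee.
have fK z : z * f * f = z * f by rewrite -mulgA ff.
set a := star (e * f).
have efaef : e * f * a * e * f = e * f.
  by rewrite -(mulgA _ e f) mulgstar.
have aefa z : z * a * e * f * a = z * a.
  by rewrite -(mulgA _ e f) -(mulgA z a) -(mulgA z) starmulg.
have bb : f * a * e * (f * a * e) = f * a * e by rewrite !mulgA aefa.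
suff -> : e * f = f * a * e by [].
rewrite -[RHS]idem_star //; apply: star_uniq.
  by rewrite !mulgA eK fK aefa.
by rewrite !mulgA fK eK efaef.
Qed.

Lemma idemC e f : idempotents e -> idempotents f -> e * f = f * e.
Proof.
move=> ee ff; have efef := idemM ee ff; have fefe := idemM ff ee.
rewrite -[RHS]idem_star //; apply: star_uniq.
- by move: fefe; rewrite /idempotents /= !mulgA -(mulgA _ e e) ee
    -(mulgA _ f f) ff.
- by move: efef; rewrite /idempotents /= !mulgA -(mulgA _ e e) ee
    -(mulgA _ f f) ff.
Qed.

End InverseSemigroupTheory.

Definition pdom (X Y : Type) (h : X -> option Y) : set X :=
  [set x | exists y, h x = Some y].

(* A homeomorphism [U -> V] between open subsets of [X] is encoded by the      *)
(* partial map it defines together with the partial map of its inverse, so     *)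
(* that [U] and [V] are the domains of these two maps, and Leibniz equality    *)
(* is equality of partial homeomorphisms. As [U] and [V] are open in [X], a    *)
(* subset of either one is relatively open iff it is open in [X].              *)
Record phomeo (X : topologicalType) := PHomeo {
  phfun :> X -> option X;
  phinv : X -> option X;
  phfunK : forall x y, phfun x = Some y <-> phinv y = Some x;
  open_phdom : open (pdom phfun);
  open_phcod : open (pdom phinv);
  phfun_continuous : forall W : set X, open W -> open (phfun @^-1` (Some @` W));
  phinv_continuous : forall W : set X, open W -> open (phinv @^-1` (Some @` W))
}.

Section PartialHomeomorphisms.
Variable X : topologicalType.
Implicit Types h k : phomeo X.

HB.instance Definition _ := gen_eqMixin (phomeo X).
HB.instance Definition _ := gen_choiceMixin (phomeo X).

Lemma phomeoP h k : (forall x y, h x = Some y -> k x = Some y) ->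
  (forall x y, k x = Some y -> h x = Some y) -> h = k.
Proof.
case: h k => [h h' hK ? ? ? ?] [k k' kK ? ? ? ?] /= hk kh.
have eq_part (f g : X -> option X) : (forall x y, f x = Some y -> g x = Some y) ->
    (forall x y, g x = Some y -> f x = Some y) -> f = g.
  move=> fg gf; apply/funext => x.
  case fx : (f x) => [y|]; first by rewrite (fg _ _ fx).
  by case gx : (g x) => [y|//]; rewrite (gf _ _ gx) in fx.
have e : h = k by exact: eq_part.
have e' : h' = k'.
  apply: eq_part => y x; first by move=> /hK /hk /kK.
  by move=> /kK /kh /hK.
by subst k k'; congr PHomeo; exact: Prop_irrelevance.
Qed.

Lemma phomeo_inj h x x' y : h x = Some y -> h x' = Some y -> x = x'.
Proof. by move=> /phfunK hx /phfunK; rewrite hx => -[]. Qed.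

Lemma phcomp_K h k x y : obind k (h x) = Some y <->
  obind (phinv h) (phinv k y) = Some x.
Proof.
split.
- case hx : (h x) => [z|//] /= /phfunK -> /=; exact/phfunK.
- case kx : (phinv k y) => [z|//] /= /phfunK -> /=; exact/phfunK.
Qed.

Lemma preimage_obind (f g : X -> option X) (W : set X) :
  (fun x => obind g (f x)) @^-1` (Some @` W) =
  f @^-1` (Some @` (g @^-1` (Some @` W))).
Proof.
apply/seteqP; split => x /=.
- case fx : (f x) => [z|] /=; first by move=> ?; exists z.
  by case.
- by move=> [z [w Ww gz] <-] /=; exists w.
Qed.

Lemma pdom_obind (f g : X -> option X) :
  pdom (fun x => obind g (f x)) = f @^-1` (Some @` (pdom g)).
Proof.
apply/seteqP; split => x /=; rewrite /pdom /=.
- by case: (f x) => [z|] [y] //= gz; exists z => //; exists y.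
- by move=> [z [y gz] <-]; exists y.
Qed.

(* Composition in diagrammatic order: first [h], then [k].                     *)
Program Definition phcomp h k : phomeo X :=
  @PHomeo X (fun x => obind k (h x)) (fun y => obind (phinv h) (phinv k y))
    (phcomp_K h k) _ _ _ _.
Next Obligation.
by move=> h k; rewrite pdom_obind; apply/phfun_continuous/open_phdom.
Qed.
Next Obligation.
by move=> h k; rewrite pdom_obind; apply/phinv_continuous/open_phcod.
Qed.
Next Obligation.
move=> h k W oW; rewrite preimage_obind.
exact/phfun_continuous/phfun_continuous.
Qed.
Next Obligation.
move=> h k W oW; rewrite preimage_obind.
exact/phinv_continuous/phinv_continuous.
Qed.

Definition phstar h : phomeo X :=
  PHomeo (fun x y => iff_sym (phfunK h y x)) (open_phcod h) (open_phdom h)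
    (phinv_continuous h) (phfun_continuous h).

Lemma phcompA : associative phcomp.
Proof.
by move=> h k l; apply: phomeoP => x y /=; case: (h x).
Qed.

HB.instance Definition _ := isSemigroup.Build (phomeo X) phcompA.

Lemma phmulE h k x : (h * k) x = obind k (h x).
Proof. by []. Qed.

Lemma phmulstar h : h * phstar h * h = h.
Proof.
apply: phomeoP => x y; rewrite !phmulE /=; case hx : (h x) => [z|//] /=.
  by have /phfunK -> := hx; rewrite /= hx.
by move=> [<-]; have /phfunK -> := hx.
Qed.

Lemma phstarK h : phstar (phstar h) = h.
Proof. by apply: phomeoP. Qed.

Lemma phstarmul h : phstar h * h * phstar h = phstar h.
Proof. by rewrite -{2}(phstarK h) phmulstar. Qed.

Lemma phstar_uniq h k : h * k * h = h -> k * h * k = k -> k = phstar h.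
Proof.
move=> hkh khk.
have inv (f g : phomeo X) : f * g * f = f -> forall x y, f x = Some y ->
    g y = Some x.
  move=> fgf x y fx; move: (fx); rewrite -{1}fgf !phmulE fx /=.
  by case gy : (g y) => [x'|//] /= /phomeo_inj -/(_ _ fx) ->.
apply: phomeoP => y x /=; first by move=> /(inv _ _ khk) /phfunK.
by move=> /phfunK; exact: inv.
Qed.

HB.instance Definition _ := Semigroup_isInverse.Build (phomeo X)
  phmulstar phstarmul phstar_uniq.

Lemma phidem h x y : idempotents h -> h x = Some y -> y = x.
Proof.
move=> hh hx; have := hx; rewrite -{1}hh phmulE hx /= => hy.
exact: phomeo_inj hy hx.
Qed.

End PartialHomeomorphisms.

Section Germs.
Variables (X : topologicalType) (S : inverseSemigroupType).
Variable rho : {multiplicative S -> phomeo X}.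
Implicit Types (x y z : X) (s t f : S) (U : set X).

Definition wide : Prop :=
  \bigcup_(f in idempotents (S := S)) pdom (rho f) = setT.

Lemma rep_idem f : idempotents f -> idempotents (rho f).
Proof. by move=> ff; rewrite /idempotents /= -gmulfM ff. Qed.

Lemma rep_star s : rho (star s) = star (rho s).
Proof.
by apply: star_uniq; rewrite -!gmulfM ?mulgstar ?starmulg.
Qed.

Lemma rep_starP s x y : rho s x = Some y -> rho (star s) y = Some x.
Proof. by move=> sx; rewrite rep_star; exact/phfunK. Qed.

Lemma rep_mulP s t x y z :
  rho s x = Some y -> rho t y = Some z -> rho (s * t) x = Some z.
Proof. by move=> sx ty; rewrite gmulfM phmulE sx. Qed.

Definition germ x s : set S :=
  [set t | exists f, [/\ idempotents f, f * t = f * s,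
    pdom (rho t) x & pdom (rho f) x]].

Lemma germ_refl x s : pdom (rho s) x -> germ x s s.
Proof.
move=> [y sx]; exists (s * star s); split => //; last 2 first.
- by exists y.
- by exists x; apply: (rep_mulP sx); exact: rep_starP.
- exact: mulgstar_idem.
Qed.

Lemma germ_eq x s t f : idempotents f -> pdom (rho f) x ->
  f * s = f * t -> germ x s = germ x t.
Proof.
move=> ff fx fst.
suff sub s' t' : f * s' = f * t' -> germ x s' `<=` germ x t'.
  by apply/seteqP; split; apply: sub.
move=> fst' w [g [gg gw wx gx]].
exists (f * g); split => //; first exact: idemM.
  by rewrite (idemC ff gg) -!mulgA -fst' !mulgA -(idemC ff gg) -!mulgA gw.
move: fx gx => [y fx] [z gx]; exists z.
by apply: (rep_mulP fx); rewrite (phidem (rep_idem ff) fx).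
Qed.

Record Germs := MkGerms {
  germs_val : X * set S;
  germs_valP : exists2 s, pdom (rho s) germs_val.1 &
    germs_val.2 = germ germs_val.1 s
}.

Lemma germs_val_inj : injective germs_val.
Proof.
move=> [a pa] [b pb] /= ab; subst b; congr MkGerms; exact: Prop_irrelevance.
Qed.

Lemma germ_arrowP s x y (sx : rho s x = Some y) :
  exists2 t, pdom (rho t) x & germ x s = germ x t.
Proof. by exists s => //; exists y. Qed.

(* The germ of [s] at [x], seen as an arrow from [x] to [y = rho s x].         *)
Definition germ_arrow s x y (sx : rho s x = Some y) : Germs :=
  @MkGerms (x, germ x s) (germ_arrowP sx).

HB.instance Definition _ := gen_eqMixin Germs.
HB.instance Definition _ := gen_choiceMixin Germs.

Definition germ_basic s U : set Germs :=
  [set g | exists2 x, U x & germs_val g = (x, germ x s)].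

Definition germ_basis : set (set Germs) :=
  [set V | exists s U, [/\ open U, U `<=` pdom (rho s) & V = germ_basic s U]].

Lemma germ_basis_cover : \bigcup_(V in germ_basis) V = setT.
Proof.
apply/seteqP; split => // g _; case: (germs_valP g) => s sx gs.
exists (germ_basic s (pdom (rho s))); last first.
  by exists (germs_val g).1 => //; rewrite -gs; case: (germs_val g).
by exists s, (pdom (rho s)); split => //; exact: open_phdom.
Qed.

Lemma germ_basis_join (V W : set Germs) g :
  germ_basis V -> germ_basis W -> V g -> W g ->
  exists V', [/\ germ_basis V', V' g & V' `<=` V `&` W].
Proof.
move=> [s [U [oU Us ->]]] [t [U' [oU' Ut ->]]] [x Ux gx] [x' U'x'].
rewrite gx => -[xx' gst]; subst x'.
have : germ x t s by rewrite -gst; exact/germ_refl/Us.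
move=> [f [ff fst _ fx]].
pose N := U `&` U' `&` pdom (rho f).
exists (germ_basic s N); split.
- exists s, N; split => //; last by move=> y [[/Us]].
  apply: openI; [exact: openI|exact: open_phdom].
- by exists x.
- move=> g' [y [[Uy U'y] fy] g'y]; split; first by exists y.
  by exists y => //; rewrite g'y (germ_eq ff fy fst).
Qed.

HB.instance Definition _ := isBaseTopological.Build Germs
  germ_basis_cover germ_basis_join.

End Germs.

Section TopologicalGroupoids.
Variables G1 G0 : topologicalType.

Definition composable (d r : G1 -> G0) : set (G1 * G1) :=
  [set p | r p.1 = d p.2].

(* The fibred product [composable gdom gran] carries, as the type of a set,    *)
(* the subspace topology of the product topology.                              *)
Record groupoidMaps := GroupoidMaps {
  gdom : G1 -> G0;
  gran : G1 -> G0;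
  gunit : G0 -> G1;
  ginv : G1 -> G1;
  gmul : composable gdom gran -> G1
}.

Definition gcomp (G : groupoidMaps) (a b : G1) (ab : gran G a = gdom G b) : G1 :=
  gmul (exist _ (a, b) (mem_set ab) : composable (gdom G) (gran G)).

Record topological_groupoid (G : groupoidMaps) : Prop := TopologicalGroupoid {
  gdom_continuous : continuous (gdom G);
  gran_continuous : continuous (gran G);
  gunit_continuous : continuous (gunit G);
  ginv_continuous : continuous (ginv G);
  gmul_continuous : continuous (@gmul G);
  gdom_unit : forall x, gdom G (gunit G x) = x;
  gran_unit : forall x, gran G (gunit G x) = x;
  gdom_inv : forall a, gdom G (ginv G a) = gran G a;
  gran_inv : forall a, gran G (ginv G a) = gdom G a;
  gdom_comp : forall a b (ab : gran G a = gdom G b), gdom G (gcomp ab) = gdom G a;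
  gran_comp : forall a b (ab : gran G a = gdom G b), gran G (gcomp ab) = gran G b;
  gcompA : forall a b c (ab : gran G a = gdom G b) (bc : gran G b = gdom G c)
    (a_bc : gran G a = gdom G (gcomp bc)) (ab_c : gran G (gcomp ab) = gdom G c),
    gcomp a_bc = gcomp ab_c;
  gcomp1l : forall a (e : gran G (gunit G (gdom G a)) = gdom G a), gcomp e = a;
  gcomp1r : forall a (e : gran G a = gdom G (gunit G (gran G a))), gcomp e = a;
  gcompV : forall a (e : gran G a = gdom G (ginv G a)),
    gcomp e = gunit G (gdom G a);
  gcompVl : forall a (e : gran G (ginv G a) = gdom G a),
    gcomp e = gunit G (gran G a)
}.

End TopologicalGroupoids.

(* Each point has an open neighbourhood [U] with open image such that [f]      *)
(* restricts to a homeomorphism [U -> f @` U], with inverse the restriction    *)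
(* of [g].                                                                     *)
Definition local_homeomorphism (X Y : topologicalType) (f : X -> Y) : Prop :=
  forall x : X, exists (U : set X) (g : Y -> X),
    [/\ open U /\ U x, open (f @` U), {within U, continuous f},
        {within f @` U, continuous g} & {in U, cancel f g}].

Definition etale (G1 G0 : topologicalType) (G : groupoidMaps G1 G0) : Prop :=
  local_homeomorphism (gdom G).

(* Main.v *)
Require Import Defs.
From HB Require Import structures.
From mathcomp Require Import all_boot monoid.
From mathcomp Require Import all_classical topology.

Local Open Scope classical_set_scope.
Local Open Scope group_scope.

(** An arrow of the groupoid of germs is a germ [germ x s], and two elements
    [s], [t] defined at [x] have the same germ there exactly when
    [f * s = f * t] for some idempotent [f] defined at [x].  So the operations of
    [S] induce groupoid operations as soon as they are compatible with this relation.  The range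
    is, because [rho f] is a restriction of the identity ([germ_range]).  The
    product is ([germ_mul]): an idempotent [g] which identifies [t] and [t'] at
    the point [rho s x] is transported along [s] to the idempotent
    [s * g * star s], which identifies [s * t] and [s * t'] at [x].  Idempotents
    act as identities on germs ([germ_idl], [germ_idr]); the identity at [x]
    exists by wideness and is independent of the idempotent chosen.
    Compatibility of the involution ([germ_star]) then follows from the
    uniqueness of inverses in a category.  The groupoid axioms are now read
    off from the axioms of [S] on representatives.

    Topologically, the basic sets [germ_basic s U] with [s] fixed and [U] a
    neighbourhood of [x] inside the domain of [rho s] form a neighbourhood base
    of the germ of [s] at [x], for each representative [s]
    ([nbhs_germ_arrow]).  Continuity of each structure map is therefore checked
    with the very representative in which that map is given by a formula.
    Finally [x |-> germ x s] is a continuous section of the domain map over the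
    domain of [rho s], and it maps this domain onto an open set of
    germs; this makes the domain map a local homeomorphism
    ([germ_src_local_homeomorphism]). *)

Set Implicit Arguments.
Unset Strict Implicit.
Unset Printing Implicit Defensive.

(** * Calculus of germs *)

Section GermCalculus.
Variables (X : topologicalType) (S : inverseSemigroupType).
Variable rho : {multiplicative S -> phomeo X}.
Implicit Types (x y z : X) (s t f : S).

Lemma rep_idemP f x : idempotents f -> pdom (rho f) x -> rho f x = Some x.
Proof.
by move=> ff [y fx]; rewrite fx (phidem (rep_idem rho ff) fx).
Qed.

Lemma germ_eqP x s t : pdom (rho s) x -> germ rho x s = germ rho x t ->
  exists2 f, idempotents f /\ rho f x = Some x & f * s = f * t.
Proof.
move=> sx st; have := germ_refl sx; rewrite st => -[f [ff fst _ fx]].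
by exists f => //; split=> //; exact: rep_idemP.
Qed.

Lemma germ_range x y s t :
  germ rho x s = germ rho x t -> rho s x = Some y -> rho t x = Some y.
Proof.
move=> st sx; have [|f [_ fx] fst] := germ_eqP _ st; first by exists y.
have := rep_mulP fx sx.
by rewrite fst gmulfM phmulE fx.
Qed.

Lemma idem_conj s f : idempotents f -> idempotents (s * f * star s).
Proof.
move=> ff; have ss : idempotents (star s * s).
  by rewrite /idempotents /= mulgA starmulg.
rewrite /idempotents /= -!mulgA (mulgA (star s) s) (mulgA (star s * s) f).
by rewrite (idemC ss ff) !mulgA -(mulgA _ f f) ff -(mulgA _ (star s) s)
  -(mulgA _ (star s * s)) starmulg.
Qed.

(** Commutation of the idempotents [f] and [star s * s]: conjugating [f] by [s]
    moves it across [s]. *)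
Lemma idem_conjE s f : idempotents f -> s * f * star s * s = s * f.
Proof.
move=> ff; have ss : idempotents (star s * s).
  by rewrite /idempotents /= mulgA starmulg.
by rewrite -!mulgA (idemC ff ss) !mulgA mulgstar.
Qed.

(** Transporting along [s] an idempotent [g] defined at [y] gives an idempotent
    [s * g * star s] defined at [x], and left multiplication of [s] by it is
    right multiplication by [g]; so a relation between [t] and [t'] at [y]
    becomes one between [s * t] and [s * t'] at [x]. *)
Lemma germ_mul x y s s' t t' : rho s x = Some y -> pdom (rho t) y ->
  germ rho x s = germ rho x s' -> germ rho y t = germ rho y t' ->
  germ rho x (s * t) = germ rho x (s' * t').
Proof.
move=> sx ty ss' tt'.
have [|f [ff fx] fss'] := germ_eqP _ ss'; first by exists y.
have [g [gg gy] gtt'] := germ_eqP ty tt'.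
(* First [t] is replaced by [t'], using [g] transported along [s]. *)
transitivity (germ rho x (s * t')).
  apply: (germ_eq (f := s * g * star s)); first exact: idem_conj.
    exists x; exact: rep_mulP (rep_mulP sx gy) (rep_starP sx).
  by rewrite !mulgA idem_conjE // -mulgA gtt' mulgA.
by apply: (germ_eq ff); [exists x | rewrite !mulgA fss'].
Qed.

Lemma germ_idl x f s : idempotents f -> rho f x = Some x ->
  germ rho x (f * s) = germ rho x s.
Proof.
by move=> ff fx; apply: (germ_eq ff); [exists x | rewrite mulgA ff].
Qed.

Lemma germ_idr x y s f : idempotents f -> rho s x = Some y ->
  rho f y = Some y -> germ rho x (s * f) = germ rho x s.
Proof.
move=> ff sx fy; apply: (germ_eq (f := s * f * star s)).
- exact: idem_conj.
- by exists x; exact: rep_mulP (rep_mulP sx fy) (rep_starP sx).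
- by rewrite mulgA idem_conjE // -mulgA ff.
Qed.

Lemma germ_idem x e f : idempotents e -> idempotents f ->
  rho e x = Some x -> rho f x = Some x -> germ rho x e = germ rho x f.
Proof.
move=> ee ff ex fx.
by rewrite -(germ_idl f ee ex) (germ_idr ff ex fx).
Qed.

(** Inverses in a category are unique: both sides are the germ of
    [star s * s * star t], as [s] and [t] have the same germ. *)
Lemma germ_star x y s t : rho s x = Some y ->
  germ rho x s = germ rho x t -> germ rho y (star s) = germ rho y (star t).
Proof.
move=> sx st; have tx := germ_range st sx.
have ssy := rep_starP sx; have tsy := rep_starP tx.
have ss : idempotents (star s * s) by rewrite /idempotents /= mulgA starmulg.
transitivity (germ rho y (star s * (t * star t))).
  by rewrite (germ_idr (mulgstar_idem t) ssy (rep_mulP tx tsy)).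
transitivity (germ rho y (star s * s * star t)); last first.
  by rewrite (germ_idl _ ss (rep_mulP ssy sx)).
rewrite -mulgA; apply: (germ_mul ssy) => //.
- by exists x; exact: rep_mulP tx tsy.
- by apply: (germ_mul tx) => //; exists x.
Qed.

End GermCalculus.

(** * The groupoid operations *)

Section GermGroupoid.
Variables (X : topologicalType) (S : inverseSemigroupType).
Variable rho : {multiplicative S -> phomeo X}.
Implicit Types (x y z : X) (s t f : S) (g a b c : Germs rho).

Local Notation basic := (germ_basic (rho := rho)).

Lemma germ_arrow_eq s t x y z (sx : rho s x = Some y) (tx : rho t x = Some z) :
  germ rho x s = germ rho x t -> germ_arrow sx = germ_arrow tx.
Proof. by move=> st; apply: germs_val_inj; rewrite /= st. Qed.

Definition germ_src g : X := (germs_val g).1.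

Lemma germ_rep_ex g : exists p : S * X, rho p.1 (germ_src g) = Some p.2 /\
  (germs_val g).2 = germ rho (germ_src g) p.1.
Proof. by case: (germs_valP g) => s [y sx] gs; exists (s, y). Qed.

(** One choice fixes both an element of [S] representing the germ and the value
    of that element at the source, so that the range needs no default value. *)
Definition germ_rep g : S := (projT1 (cid (germ_rep_ex g))).1.

Definition germ_tgt g : X := (projT1 (cid (germ_rep_ex g))).2.

Lemma germ_repP g : rho (germ_rep g) (germ_src g) = Some (germ_tgt g).
Proof. exact: (projT2 (cid (germ_rep_ex g))).1. Qed.

Lemma germ_arrow_rep g : germ_arrow (germ_repP g) = g.
Proof.
apply: germs_val_inj; rewrite /= -(projT2 (cid (germ_rep_ex g))).2.
by rewrite /germ_src -surjective_pairing.
Qed.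

Lemma germ_arrow_repE s x y (sx : rho s x = Some y) :
  germ rho x (germ_rep (germ_arrow sx)) = germ rho x s.
Proof.
by have /(congr1 (snd \o @germs_val _ _ _)) := germ_arrow_rep (germ_arrow sx).
Qed.

Lemma germ_tgt_arrow s x y (sx : rho s x = Some y) :
  germ_tgt (germ_arrow sx) = y.
Proof.
have := germ_range (esym (germ_arrow_repE sx)) sx.
by rewrite (germ_repP (germ_arrow sx)) => -[].
Qed.

Definition germ_inv g : Germs rho := germ_arrow (rep_starP (germ_repP g)).

Lemma germ_inv_arrow s x y (sx : rho s x = Some y) :
  germ_inv (germ_arrow sx) = germ_arrow (rep_starP sx).
Proof.
apply: germs_val_inj => /=.
have := germ_repP (germ_arrow sx); rewrite germ_tgt_arrow => rx.
by rewrite (germ_star rx (germ_arrow_repE sx)).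
Qed.

Lemma germ_rep_compP (p : composable germ_src germ_tgt) :
  rho (germ_rep (\val p).2) (germ_tgt (\val p).1) = Some (germ_tgt (\val p).2).
Proof. by rewrite (set_mem (valP p)) germ_repP. Qed.

Definition germ_comp (p : composable germ_src germ_tgt) : Germs rho :=
  germ_arrow (rep_mulP (germ_repP (\val p).1) (germ_rep_compP p)).

Lemma germ_comp_arrow (p : composable germ_src germ_tgt) s t x y z
    (sx : rho s x = Some y) (ty : rho t y = Some z) :
  \val p = (germ_arrow sx, germ_arrow ty) ->
  germ_comp p = germ_arrow (rep_mulP sx ty).
Proof.
move=> pE; apply: germs_val_inj => /=; rewrite pE /=; congr pair.
have rx := germ_repP (germ_arrow sx); rewrite germ_tgt_arrow in rx.
apply: (germ_mul rx); [|exact: germ_arrow_repE..].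
by have ry := germ_repP (germ_arrow ty); exists (germ_tgt (germ_arrow ty)).
Qed.

Hypothesis rho_wide : wide rho.

Lemma wide_idem_ex x : exists f, idempotents f /\ rho f x = Some x.
Proof.
have : [set: X] x by [].
rewrite -rho_wide => -[f ff fx]; exists f; split=> //; exact: rep_idemP.
Qed.

Definition germ_unit x : Germs rho :=
  germ_arrow (projT2 (cid (wide_idem_ex x))).2.

Lemma germ_unit_arrow f x y (fx : rho f x = Some y) :
  idempotents f -> germ_unit x = germ_arrow fx.
Proof.
move=> ff; apply: germ_arrow_eq.
case: (cid (wide_idem_ex x)) => e [ee ex] /=; apply: germ_idem => //.
by apply: rep_idemP => //; exists y.
Qed.

Definition germ_groupoid : groupoidMaps (Germs rho) X :=
  GroupoidMaps germ_unit germ_inv germ_comp.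

(** The representatives are hypotheses on [a] and [b], rather than [a] and [b]
    being germs of given elements, so that the equation applies whatever the
    form of the factors and of the composability proof. *)
Lemma gcomp_germ a b (ab : gran germ_groupoid a = gdom germ_groupoid b) s t x y z
    (sx : rho s x = Some y) (ty : rho t y = Some z) :
  a = germ_arrow sx -> b = germ_arrow ty ->
  gcomp ab = germ_arrow (rep_mulP sx ty).
Proof. by move=> aE bE; apply: germ_comp_arrow; rewrite /= aE bE. Qed.

Lemma germ_arrowP a : exists s x y (sx : rho s x = Some y), a = germ_arrow sx.
Proof. by do 4!eexists; exact/esym/germ_arrow_rep. Qed.

Lemma germ_arrow_atP a x : germ_src a = x ->
  exists s y (sx : rho s x = Some y), a = germ_arrow sx.
Proof. by move=> <-; do 3!eexists; exact/esym/germ_arrow_rep. Qed.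

Lemma germ_compA a b c
    (ab : gran germ_groupoid a = gdom germ_groupoid b)
    (bc : gran germ_groupoid b = gdom germ_groupoid c)
    (a_bc : gran germ_groupoid a = gdom germ_groupoid (gcomp bc))
    (ab_c : gran germ_groupoid (gcomp ab) = gdom germ_groupoid c) :
  gcomp a_bc = gcomp ab_c.
Proof.
have [s [x [y [sx aE]]]] := germ_arrowP a.
have /germ_arrow_atP [t [z [ty bE]]] : germ_src b = y.
  by rewrite -[LHS]ab aE; exact: germ_tgt_arrow.
have /germ_arrow_atP [u [w [uz cE]]] : germ_src c = z.
  by rewrite -[LHS]bc bE; exact: germ_tgt_arrow.
rewrite (gcomp_germ a_bc aE (gcomp_germ bc bE cE)).
rewrite (gcomp_germ ab_c (gcomp_germ ab aE bE) cE).
by apply: germ_arrow_eq; rewrite mulgA.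
Qed.

Lemma germ_comp1l a
    (e : gran germ_groupoid (germ_unit (germ_src a)) = gdom germ_groupoid a) :
  gcomp e = a.
Proof.
have [s [x [y [sx aE]]]] := germ_arrowP a.
have [f [ff fx]] := wide_idem_ex x.
have uE : germ_unit (germ_src a) = germ_arrow fx.
  by rewrite aE; exact: germ_unit_arrow.
rewrite (gcomp_germ e uE aE) aE; apply: germ_arrow_eq; exact: germ_idl.
Qed.

Lemma germ_comp1r a
    (e : gran germ_groupoid a = gdom germ_groupoid (germ_unit (germ_tgt a))) :
  gcomp e = a.
Proof.
have [s [x [y [sx aE]]]] := germ_arrowP a.
have [f [ff fy]] := wide_idem_ex y.
have uE : germ_unit (germ_tgt a) = germ_arrow fy.
  by rewrite aE germ_tgt_arrow; exact: germ_unit_arrow.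
rewrite (gcomp_germ e aE uE) aE; apply: germ_arrow_eq.
exact: germ_idr ff sx fy.
Qed.

Lemma germ_compV a
    (e : gran germ_groupoid a = gdom germ_groupoid (germ_inv a)) :
  gcomp e = germ_unit (germ_src a).
Proof.
have [s [x [y [sx aE]]]] := germ_arrowP a.
have iE : germ_inv a = germ_arrow (rep_starP sx) by rewrite aE germ_inv_arrow.
rewrite (gcomp_germ e aE iE) aE; apply/esym/germ_unit_arrow.
exact: mulgstar_idem.
Qed.

Lemma germ_compVl a
    (e : gran germ_groupoid (germ_inv a) = gdom germ_groupoid a) :
  gcomp e = germ_unit (germ_tgt a).
Proof.
have [s [x [y [sx aE]]]] := germ_arrowP a.
have iE : germ_inv a = germ_arrow (rep_starP sx) by rewrite aE germ_inv_arrow.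
rewrite (gcomp_germ e iE aE) aE germ_tgt_arrow; apply/esym/germ_unit_arrow.
by rewrite /idempotents /= mulgA starmulg.
Qed.

(** * Topology of the space of germs *)

Lemma open_germ_basic s (U : set X) :
  open U -> U `<=` pdom (rho s) -> open (basic s U).
Proof.
move=> oU Us; exists [set basic s U]; last exact: bigcup_set1.
by move=> _ ->; exists s, U.
Qed.

Lemma germ_basic_arrow s x y (sx : rho s x = Some y) (U : set X) :
  basic s U (germ_arrow sx) <-> U x.
Proof. by split=> [[x' Ux' [->]]//|Ux]; exists x. Qed.

Lemma germ_basicP s (U : set X) a : U `<=` pdom (rho s) -> basic s U a ->
  exists x y (sx : rho s x = Some y), U x /\ a = germ_arrow sx.
Proof.
move=> Us [x Ux ax]; have [y sx] := Us _ Ux.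
by exists x, y, sx; split=> //; exact: germs_val_inj.
Qed.

(** A basic neighbourhood may come from another representative [t] of the
    germ; on a smaller open set it is also the basic set of [s], since [s] and
    [t] have the same germs wherever the idempotent identifying them is
    defined. *)
Lemma nbhs_germ_arrow s x y (sx : rho s x = Some y) (A : set (Germs rho)) :
  nbhs (germ_arrow sx) A <-> exists U : set X,
    [/\ open U, U x, U `<=` pdom (rho s) & basic s U `<=` A].
Proof.
split=> [|[U [oU Ux Us UA]]]; last first.
  rewrite nbhsE; exists (basic s U) => //; split.
    exact: open_germ_basic.
  exact/germ_basic_arrow.
rewrite nbhsE => -[_ [[D Dbasis <-] [V DV Vsx]] VA].
have [t [U [oU Ut VE]]] := Dbasis _ DV.
move: Vsx; rewrite VE => -[x' Ux [xx' st]]; subst x'.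
have [|f [ff fx] fst] := germ_eqP _ st; first by exists y.
exists (U `&` pdom (rho s) `&` pdom (rho f)); split.
- by apply: openI; [apply: openI => //|]; exact: open_phdom.
- by split; [split=> //; exists y|exists x].
- by move=> z [[_ sz] _].
- move=> g [z [[Uz _] fz] gz]; apply: VA; exists V => //.
  by rewrite VE; exists z => //; rewrite gz (germ_eq ff fz fst).
Qed.

Lemma open_phomeo_preimage (h : phomeo X) (W : set X) : open W ->
  open [set x | exists2 y, W y & h x = Some y].
Proof.
move=> /(phfun_continuous h); congr open.
by apply/seteqP; split=> x /= [y Wy]; exists y.
Qed.

Lemma germ_src_continuous : continuous germ_src.
Proof.
move=> a A; have [s [x [y [sx ->]]]] := germ_arrowP a.
rewrite nbhsE => -[W [oW Wx] WA]; apply/nbhs_germ_arrow.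
exists (W `&` pdom (rho s)); split.
- by apply: openI => //; exact: open_phdom.
- by split=> //; exists y.
- by move=> z [].
- by move=> g [z [Wz _] gz]; apply: WA; rewrite /germ_src gz.
Qed.

Lemma germ_tgt_continuous : continuous germ_tgt.
Proof.
move=> a A; have [s [x [y [sx ->]]]] := germ_arrowP a.
rewrite germ_tgt_arrow nbhsE => -[W [oW Wy] WA]; apply/nbhs_germ_arrow.
have Us : [set z | exists2 w, W w & rho s z = Some w] `<=` pdom (rho s).
  by move=> z [w _ sz]; exists w.
exists [set z | exists2 w, W w & rho s z = Some w]; split=> //.
- exact: open_phomeo_preimage.
- by exists y.
- move=> g /(germ_basicP Us) [z [w [sz [[w' Ww' sz'] ->]]]]; apply: WA.
  by move: Ww'; rewrite germ_tgt_arrow; move: sz'; rewrite sz => -[<-].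
Qed.

Lemma germ_unit_continuous : continuous germ_unit.
Proof.
move=> x A; have [f [ff fx]] := wide_idem_ex x.
rewrite (germ_unit_arrow fx ff) => /nbhs_germ_arrow [U [oU Ux Uf UA]].
rewrite nbhsE; exists U => // z Uz; apply: UA.
have [w fz] := Uf _ Uz; rewrite (germ_unit_arrow fz ff).
exact/germ_basic_arrow.
Qed.

Lemma germ_inv_continuous : continuous germ_inv.
Proof.
move=> a A; have [s [x [y [sx ->]]]] := germ_arrowP a.
rewrite germ_inv_arrow => /nbhs_germ_arrow [U [oU Uy Us UA]].
have Vs : [set z | exists2 w, U w & rho s z = Some w] `<=` pdom (rho s).
  by move=> z [w _ sz]; exists w.
apply/nbhs_germ_arrow; exists [set z | exists2 w, U w & rho s z = Some w].
split=> //.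
- exact: open_phomeo_preimage.
- by exists y.
- move=> g /(germ_basicP Vs) [z [w [sz [[w' Uw' sz'] ->]]]]; apply: UA.
  rewrite germ_inv_arrow; apply/germ_basic_arrow.
  by move: sz' Uw'; rewrite sz => -[<-].
Qed.

(** If [U] lies in the domain of [rho (s * t)], then the products of the germs
    of [s] over [U] with all germs of [t] are germs of [s * t] over [U]. *)
Lemma germ_comp_continuous : continuous germ_comp.
Proof.
move=> p A.
have [s [x [y [sx aE]]]] := germ_arrowP (\val p).1.
have /germ_arrow_atP [t [z [ty bE]]] : germ_src (\val p).2 = y.
  by rewrite -[LHS](set_mem (valP p)) aE germ_tgt_arrow.
have pE : \val p = (germ_arrow sx, germ_arrow ty).
  by rewrite -aE -bE -surjective_pairing.
rewrite (germ_comp_arrow pE) => /nbhs_germ_arrow [U [oU Ux Ust UA]].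
have Us : U `<=` pdom (rho s).
  move=> v /Ust [w]; rewrite gmulfM phmulE.
  by case sv : (rho s v) => [v'|//] _; exists v'.
pose B := basic s U `*` basic t (pdom (rho t)).
have nB : nbhs (\val p) B.
  exists (basic s U, basic t (pdom (rho t))) => //=.
  rewrite pE /=; split; apply/nbhs_germ_arrow.
    by exists U; split.
  by exists (pdom (rho t)); split=> //; [exact: open_phdom|exists z].
have sB : \val @^-1` B `<=` germ_comp @^-1` A.
  move=> q [/(germ_basicP Us) [x' [y' [sx' [Ux' q1]]]]].
  move=> /(germ_basicP (@subset_refl _ _)) [y'' [z' [ty' [_ q2]]]].
  have qy : y'' = y'.
    by have := set_mem (valP q); rewrite /composable /= q1 q2 germ_tgt_arrow.
  subst y''; have qE : \val q = (germ_arrow sx', germ_arrow ty').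
    by rewrite -q1 -q2 -surjective_pairing.
  by apply: UA; rewrite (germ_comp_arrow qE); exact/germ_basic_arrow.
have nV : nbhs p (\val @^-1` B).
  exact: (@initial_continuous _ _ (@set_val _ (composable germ_src germ_tgt))).
exact: (@filterS _ _ (nbhs_filter p) _ _ sB nV).
Qed.

(** Near the germ of [s] at [x] the inverse of the domain map is the section
    [z |-> germ z s] over the domain of [rho s]. *)
Lemma germ_src_local_homeomorphism : local_homeomorphism germ_src.
Proof.
move=> a; have [s [x [y [sx aE]]]] := germ_arrowP a.
pose D := pdom (rho s); have oD : open D := open_phdom (rho s).
(* [xget] needs a default germ for the points outside of the domain of
   [rho s]; the given [a] provides one. *)
pose sec z := xget a [set g | germs_val g = (z, germ rho z s)].
have secE z w (sz : rho s z = Some w) : sec z = germ_arrow sz.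
  apply: germs_val_inj.
  exact: (@xgetI _ a [set g | germs_val g = (z, germ rho z s)] (germ_arrow sz)).
have srcD : germ_src @` basic s D = D.
  apply/seteqP; split=> [_ [g [z Dz gz] <-]|z [w sz]].
    by rewrite /germ_src gz.
  by exists (germ_arrow sz) => //; apply/germ_basic_arrow; exists w.
exists (basic s D), sec; rewrite srcD; split=> //.
- split; first exact: open_germ_basic.
  by rewrite aE; apply/germ_basic_arrow; exists y.
- exact/continuous_subspaceT/germ_src_continuous.
- apply/subspace_continuousP => z [w sz]; apply: cvg_within_filter.
  suff : sec @ z --> germ_arrow sz by rewrite -(secE _ _ sz).
  move=> A /nbhs_germ_arrow [U [oU Uz Us UA]].
  rewrite nbhs_filterE nbhsE; exists U => // v Uv; apply: UA.
  by have [v' sv] := Us _ Uv; rewrite (secE _ _ sv); exact/germ_basic_arrow.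
- move=> g /set_mem /(germ_basicP (@subset_refl _ _)) [z [w [sz [_ ->]]]].
  exact: secE.
Qed.

End GermGroupoid.

Theorem mainTheorem1 (X : topologicalType) (S : inverseSemigroupType)
    (rho : {multiplicative S -> phomeo X}) (rho_wide : wide rho) :
  exists G : groupoidMaps (Germs rho) X,
    [/\ topological_groupoid G,
        etale G &
        [/\ (forall (s : S) (x y : X) (sx : rho s x = Some y),
              gdom G (germ_arrow sx) = x),
            (forall (s : S) (x y : X) (sx : rho s x = Some y),
              gran G (germ_arrow sx) = y),
            (forall (f : S) (x y : X) (fx : rho f x = Some y),
              idempotents f -> gunit G x = germ_arrow fx),
            (forall (s t : S) (x y z : X)
                (sx : rho s x = Some y) (ty : rho t y = Some z)
                (st : gran G (germ_arrow sx) = gdom G (germ_arrow ty)),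
              gcomp st = germ_arrow (rep_mulP sx ty)) &
            (forall (s : S) (x y : X) (sx : rho s x = Some y),
              ginv G (germ_arrow sx) = germ_arrow (rep_starP sx))]].
Proof.
exists (germ_groupoid rho_wide); split.
- split.
  + exact: germ_src_continuous.
  + exact: germ_tgt_continuous.
  + exact: germ_unit_continuous.
  + exact: germ_inv_continuous.
  + exact: germ_comp_continuous.
  + by [].
  + by move=> x; exact: germ_tgt_arrow.
  + by [].
  + by move=> a; exact: germ_tgt_arrow.
  + by [].
  + by move=> a b ab; exact: germ_tgt_arrow.
  + exact: germ_compA.
  + exact: germ_comp1l.
  + exact: germ_comp1r.
  + exact: germ_compV.
  + exact: germ_compVl.
- exact: germ_src_local_homeomorphism.
- split.
  + by [].
  + exact: germ_tgt_arrow.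
  + exact: germ_unit_arrow.
  + by move=> s t x y z sx ty st; exact: gcomp_germ.
  + exact: germ_inv_arrow.
Qed.
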